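(* Let $\tilde{\mathcal{C}}\subset S^2_B\Lambda^2\mathbb{R}^4$ be any Ricci flow invariant curvature cone which contains all nonnegative curvature operators (i.e. all $\mathrm{R}\in S^2_B\Lambda^2\mathbb{R}^4$ that are positive semidefinite as symmetric operators on $\Lambda^2\mathbb{R}^4$), and let \[\mathcal{C}=\left\{\mathrm{R}\in S^2_B\Lambda^2\mathbb{R}^4 \;:\; \tfrac{\mathrm{Scal}}{12}\,\mathrm{I}+W\in\tilde{\mathcal{C}}\right\},\] where $\mathrm{Scal}$ and $W$ are the scalar curvature and the Weyl component of $\mathrm{R}$. Then $\mathcal{C}$ is a Ricci flow invariant curvature cone which contains all conformally flat scalar flat curvature operators, i.e. $S^2_0\mathbb{R}^4\wedge\mathrm{id}\subset\mathcal{C}$.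
   Context: Here $n=4$. $\mathbb{R}^n$ has its standard Euclidean structure and $\Lambda^2\mathbb{R}^n$ the inner product $\langle x\wedge y,z\wedge t\rangle=\langle x,z\rangle\langle y,t\rangle-\langle x,t\rangle\langle y,z\rangle$. $S^2_B\Lambda^2\mathbb{R}^n$ is the space of algebraic curvature operators: symmetric endomorphisms $\mathrm{R}$ of $\Lambda^2\mathbb{R}^n$ satisfying the first Bianchi identity $\langle \mathrm{R}(x\wedge y),z\wedge t\rangle+\langle \mathrm{R}(z\wedge x),y\wedge t\rangle+\langle \mathrm{R}(y\wedge z),x\wedge t\rangle=0$ for all $x,y,z,t\in\mathbb{R}^n$. The group $O(n)$ acts by $\langle (g.\mathrm{R})(x\wedge y),z\wedge t\rangle=\langle \mathrm{R}(gx\wedge gy),gz\wedge gt\rangle$. The Ricci tensor of $\mathrm{R}$ is the symmetric operator $\rho(\mathrm{R})$ on $\mathbb{R}^n$ with $\langle\rho(\mathrm{R})x,y\rangle=\sum_i\langle \mathrm{R}(x\wedge e_i),y\wedge e_i\rangle$ for an orthonormal basis $(e_i)$; the scalar curvature $\mathrm{Scal}$ is twice the trace of $\mathrm{R}$. For symmetric $A,B:\mathbb{R}^n\to\mathbb{R}^n$ let $(A\wedge B)(x\wedge y)=\frac12(Ax\wedge By+Bx\wedge Ay)$. There is an $O(n)$-invariant orthogonal decomposition $S^2_B\Lambda^2\mathbb{R}^n=\mathbb{R}\mathrm{I}\oplus(S^2_0\mathbb{R}^n\wedge\mathrm{id})\oplus\mathcal{W}$, where $\mathrm{I}$ is the identity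 of $\Lambda^2\mathbb{R}^n$, $S^2_0\mathbb{R}^n\wedge\mathrm{id}=\{A_0\wedge\mathrm{id} : A_0 \text{ symmetric},\ \mathrm{trace}A_0=0\}$ (the conformally flat scalar flat curvature operators) and $\mathcal{W}=\ker\rho$ (the Weyl operators). The Weyl component $W$ of $\mathrm{R}$ is its component in $\mathcal{W}$; for $n=4$ its component in $\mathbb{R}\mathrm{I}$ is $\frac{\mathrm{Scal}}{12}\mathrm{I}$. A curvature cone is a closed convex cone $\mathcal{C}\subset S^2_B\Lambda^2\mathbb{R}^n$ which is $O(n)$-invariant and contains $\mathrm{I}$ in its interior. Define the quadratic vector field $Q(\mathrm{R})=\mathrm{R}^2+\mathrm{R}^\#$ on $S^2_B\Lambda^2\mathbb{R}^n$, where $\mathrm{R}^2$ is the square as an endomorphism and $\mathrm{R}^\#$ is the symmetric operator with $\langle \mathrm{R}^\#\eta,\eta\rangle=-\frac12\sum_i\langle[\eta,\mathrm{R}([\eta,\mathrm{R}(\omega_i)])],\omega_i\rangle$, $(\omega_i)$ being an orthonormal basis of $\Lambda^2\mathbb{R}^n$ and the Lie bracket coming from the identification $\Lambda^2\mathbb{R}^n\simeq\mathfrak{so}(n,\mathbb{R})$, $x\wedge y\mapsto(u\mapsto\langle x,u\rangle y-\langle y,u\rangle x)$. A curvature cone $\mathcal{C}$ is Ricci flow invariant if $Q(\mathrm{R})\in T_{\mathrm{R}}\mathcal{C}$ for every $\mathrm{R}\in\partial\mathcal{C}$, where the tangent cone $T_{\mathrm{R}}\mathcal{C}$ is the closure of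 $\{\mathrm{L} : \exists t>0,\ \mathrm{R}+t\mathrm{L}\in\mathcal{C}\}$. Equivalently, solutions of $\frac{d}{dt}\mathrm{R}=Q(\mathrm{R})$ starting in $\mathcal{C}$ stay in $\mathcal{C}$ for positive times. *)

(* Defs.v *)
From mathcomp Require Import all_boot all_order all_algebra.
From mathcomp Require Import ring lra.
From mathcomp Require Import all_classical all_reals all_analysis.

Set Implicit Arguments.
Unset Strict Implicit.
Unset Printing Implicit Defensive.

Import Order.TTheory GRing.Theory Num.Theory.
Import numFieldNormedType.Exports.

Local Open Scope classical_set_scope.
Local Open Scope ring_scope.

(* Lambda^2 R^4 is 'cV[R]_6, in coordinates with respect to the basis
   e_i /\ e_j (i < j) in lexicographic order: the k-th basis vector is
   e_(ilo k) /\ e_(ihi k). This basis is orthonormal for the inner product of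
   Lambda^2 R^4 (see [inner_wedge]), which is therefore the coordinatewise one,
   and endomorphisms of Lambda^2 R^4 are matrices in 'M[R]_6. *)
Definition ilo (k : 'I_6) : 'I_4 := [:: 0; 0; 0; 1; 1; 2]`_k.
Definition ihi (k : 'I_6) : 'I_4 := [:: 1; 2; 3; 2; 3; 3]`_k.

Section CurvatureOperators.
Variable R : realType.

Implicit Types (x y z t : 'cV[R]_4) (eta zeta : 'cV[R]_6).
Implicit Types (g A B : 'M[R]_4) (Rm W : 'M[R]_6) (C : set 'M[R]_6).

Definition inner (n : nat) (u v : 'cV[R]_n) : R := \sum_(i < n) u i 0 * v i 0.

Definition ebase (n : nat) (i : 'I_n) : 'cV[R]_n := delta_mx i 0.

Definition wedge x y : 'cV[R]_6 :=
  \col_k (x (ilo k) 0 * y (ihi k) 0 - x (ihi k) 0 * y (ilo k) 0).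

Definition bianchi Rm : Prop := forall x y z t,
  inner (Rm *m wedge x y) (wedge z t) + inner (Rm *m wedge z x) (wedge y t)
  + inner (Rm *m wedge y z) (wedge x t) = 0.

Definition curv_op : set 'M[R]_6 := [set Rm | Rm^T = Rm /\ bianchi Rm].

Definition orthogonal_mx g : Prop := g^T *m g = 1%:M.

(* <(g.Rm)(x /\ y), z /\ t> = <Rm (gx /\ gy), gz /\ gt>; see [oact_wedge]. *)
Definition oact g Rm : 'M[R]_6 := \matrix_(k, l)
  inner (Rm *m wedge (g *m ebase (ilo l)) (g *m ebase (ihi l)))
        (wedge (g *m ebase (ilo k)) (g *m ebase (ihi k))).

(* <(ricci Rm) x, y> = \sum_i <Rm (x /\ e_i), y /\ e_i>; see [inner_ricci]. *)
Definition ricci Rm : 'M[R]_4 := \matrix_(a, b)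
  \sum_i inner (Rm *m wedge (ebase b) (ebase i)) (wedge (ebase a) (ebase i)).

Definition scal Rm : R := 2 * \tr Rm.

(* (A /\ B)(x /\ y) = (Ax /\ By + Bx /\ Ay) / 2; see [wedge_op_wedge]. *)
Definition wedge_op A B : 'M[R]_6 := \matrix_(k, l)
  (2^-1 *: (wedge (A *m ebase (ilo l)) (B *m ebase (ihi l))
            + wedge (B *m ebase (ilo l)) (A *m ebase (ihi l)))) k 0.

Definition traceless_sym A : Prop := A^T = A /\ \tr A = 0.

(* S^2_0 R^4 /\ id *)
Definition conf_flat_scal_flat : set 'M[R]_6 :=
  [set wedge_op A 1%:M | A in traceless_sym].

Definition weyl_op : set 'M[R]_6 := [set W | curv_op W /\ ricci W = 0].

Definition is_weyl_component Rm W : Prop :=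
  weyl_op W /\ exists c : R, exists2 S : 'M[R]_6,
    conf_flat_scal_flat S & Rm = c *: 1%:M + S + W.

(* Well defined on curvature operators, by [weylP] and [weyl_unique]. *)
Definition weyl Rm : 'M[R]_6 := get (is_weyl_component Rm).

(* The isomorphism Lambda^2 R^4 -> so(4) sending x /\ y to
   u |-> <x, u> y - <y, u> x (see [to_so_wedge]), and its inverse. *)
Definition to_so eta : 'M[R]_4 :=
  \sum_k eta k 0 *: (delta_mx (ihi k) (ilo k) - delta_mx (ilo k) (ihi k)).
Definition of_so A : 'cV[R]_6 := \col_k A (ihi k) (ilo k).

Definition bracket eta zeta : 'cV[R]_6 :=
  of_so (to_so eta *m to_so zeta - to_so zeta *m to_so eta).

Definition sharp_form Rm eta : R :=
  - 2^-1 * \sum_i inner (bracket eta (Rm *m bracket eta (Rm *m ebase i)))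
                        (ebase i).

(* The symmetric operator of the quadratic form [sharp_form Rm], obtained by
   polarization; see [sharp_sym], [inner_sharp] and [sharp_unique]. *)
Definition sharp Rm : 'M[R]_6 := \matrix_(k, l)
  (2^-1 * (sharp_form Rm (ebase k + ebase l)
           - sharp_form Rm (ebase k) - sharp_form Rm (ebase l))).

Definition Qfield Rm : 'M[R]_6 := Rm *m Rm + sharp Rm.

Definition nonneg_op Rm : Prop := forall eta, 0 <= inner (Rm *m eta) eta.

(* Interior and boundary are relative to the subspace [curv_op] of 'M[R]_6.
   As that subspace is closed, closedness and closures of its subsets may be
   taken in 'M[R]_6. *)
Definition cinterior C : set 'M[R]_6 :=
  [set Rm | curv_op Rm /\ within curv_op (nbhs Rm) C].
Definition cboundary C : set 'M[R]_6 :=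
  [set Rm | curv_op Rm /\ closure C Rm /\ ~ cinterior C Rm].

Definition curvature_cone C : Prop :=
  [/\ C `<=` curv_op,
      closed C,
      @convex_set R 'M[R]_6 C
      /\ (forall Rm (s : R), C Rm -> 0 < s -> C (s *: Rm)),
      (forall g Rm, orthogonal_mx g -> C Rm -> C (oact g Rm))
    & cinterior C 1%:M].

Definition tangent_cone C Rm : set 'M[R]_6 :=
  closure [set L | curv_op L /\ exists2 s : R, 0 < s & C (Rm + s *: L)].

Definition ricci_flow_invariant C : Prop :=
  forall Rm, cboundary C Rm -> tangent_cone C Rm (Qfield Rm).

End CurvatureOperators.

Section Characterizations.
Variable R : realType.

Implicit Types (x y z t : 'cV[R]_4) (eta zeta : 'cV[R]_6).
Implicit Types (g A B : 'M[R]_4) (Rm W : 'M[R]_6).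

Lemma sum4 (V : zmodType) (F : 'I_4 -> V) : \sum_i F i = F 0 + F 1 + F 2 + F 3.
Proof.
rewrite !big_ord_recr big_ord0 /= add0r.
by congr (F _ + F _ + F _ + F _); apply/val_inj.
Qed.

Lemma sum6 (V : zmodType) (F : 'I_6 -> V) :
  \sum_i F i = F 0 + F 1 + F 2 + F 3 + F 4 + F 5.
Proof.
rewrite !big_ord_recr big_ord0 /= add0r.
by congr (F _ + F _ + F _ + F _ + F _ + F _); apply/val_inj.
Qed.

Lemma all6 (P : 'I_6 -> Prop) :
  P 0 -> P 1 -> P 2 -> P 3 -> P 4 -> P 5 -> forall k, P k.
Proof.
move=> P0 P1 P2 P3 P4 P5 [k lt_k].
move: k lt_k => [|[|[|[|[|[|//]]]]]] lt_k.
- by suff -> : Ordinal lt_k = 0 by []; apply/val_inj.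
- by suff -> : Ordinal lt_k = 1 by []; apply/val_inj.
- by suff -> : Ordinal lt_k = 2 by []; apply/val_inj.
- by suff -> : Ordinal lt_k = 3 by []; apply/val_inj.
- by suff -> : Ordinal lt_k = 4 by []; apply/val_inj.
- by suff -> : Ordinal lt_k = 5 by []; apply/val_inj.
Qed.

Lemma all4 (P : 'I_4 -> Prop) : P 0 -> P 1 -> P 2 -> P 3 -> forall k, P k.
Proof.
move=> P0 P1 P2 P3 [k lt_k].
move: k lt_k => [|[|[|[|//]]]] lt_k.
- by suff -> : Ordinal lt_k = 0 by []; apply/val_inj.
- by suff -> : Ordinal lt_k = 1 by []; apply/val_inj.
- by suff -> : Ordinal lt_k = 2 by []; apply/val_inj.
- by suff -> : Ordinal lt_k = 3 by []; apply/val_inj.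
Qed.

Lemma iloE : (ilo 0 = 0) * (ilo 1 = 0) * (ilo 2 = 0) * (ilo 3 = 1) *
  (ilo 4 = 1) * (ilo 5 = 2).
Proof. by []. Qed.

Lemma ihiE : (ihi 0 = 1) * (ihi 1 = 2) * (ihi 2 = 3) * (ihi 3 = 2) *
  (ihi 4 = 3) * (ihi 5 = 3).
Proof. by []. Qed.

Lemma inner_wedge x y z t : inner (wedge x y) (wedge z t) =
  inner x z * inner y t - inner x t * inner y z.
Proof. by rewrite /inner !sum4 sum6 !mxE !iloE !ihiE; ring. Qed.

Lemma innerE n (u v : 'cV[R]_n) : inner u v = (v^T *m u) 0 0.
Proof. by rewrite mxE; apply: eq_bigr => i _; rewrite mxE mulrC. Qed.

Lemma inner_ebase n (u : 'cV[R]_n) i : inner u (ebase R i) = u i 0.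
Proof.
rewrite /inner (bigD1 i) //= big1 ?addr0 => [|j ji];
  by rewrite mxE ?eqxx ?(negPf ji) ?mulr1 ?mulr0.
Qed.

Lemma mul_ebase m n (M : 'M[R]_(m, n)) i : M *m ebase R i = col i M.
Proof. by rewrite colE. Qed.

Lemma wedge_opE A B k l : wedge_op A B k l = 2^-1 *
  (A (ilo k) (ilo l) * B (ihi k) (ihi l) - A (ihi k) (ilo l) * B (ilo k) (ihi l)
   + (B (ilo k) (ilo l) * A (ihi k) (ihi l)
      - B (ihi k) (ilo l) * A (ilo k) (ihi l))).
Proof. by rewrite mxE !mul_ebase !mxE. Qed.

Lemma wedge_op_wedge A B x y : wedge_op A B *m wedge x y =
  2^-1 *: (wedge (A *m x) (B *m y) + wedge (B *m x) (A *m y)).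
Proof.
apply/colP => k; rewrite mxE sum6 !wedge_opE !mxE !sum4 !iloE !ihiE.
by move: (ilo k) (ihi k) => i j; ring.
Qed.

Lemma oact_wedge g Rm x y z t :
  inner (oact g Rm *m wedge x y) (wedge z t) =
  inner (Rm *m wedge (g *m x) (g *m y)) (wedge (g *m z) (g *m t)).
Proof.
pose G := wedge_op g g.
have GE u v : wedge (g *m u) (g *m v) = G *m wedge u v.
  by apply/colP => k; rewrite wedge_op_wedge [RHS]mxE [_ k 0 in RHS]mxE; field.
have -> : oact g Rm = G^T *m Rm *m G.
  have GK i : wedge (g *m ebase R (ilo i)) (g *m ebase R (ihi i)) = col i G.
    by apply/colP => j; rewrite [RHS]mxE wedge_opE !mul_ebase !mxE; field.
  apply/matrixP => k l; rewrite mxE !GK innerE tr_col mulmxA -row_mul.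
  by rewrite colE mulmxA -colE -row_mul !mxE.
by rewrite !GE !innerE trmx_mul !mulmxA.
Qed.

Lemma inner_ricci Rm x y : inner (ricci Rm *m x) y =
  \sum_i inner (Rm *m wedge x (ebase R i)) (wedge y (ebase R i)).
Proof.
pose w i := \matrix_(k, b) wedge (ebase R b) (ebase R i) k 0.
have wE i u : wedge u (ebase R i) = w i *m u.
  by apply/colP => k; rewrite !mxE sum4 !mxE /=;
     move: k; apply: all6; rewrite ?iloE ?ihiE /=; ring.
have wcol i b : wedge (ebase R b) (ebase R i) = col b (w i).
  by apply/colP => k; rewrite !mxE.
have -> : ricci Rm = \sum_i (w i)^T *m Rm *m w i.
  apply/matrixP => a b; rewrite mxE summxE; apply: eq_bigr => i _.
  rewrite !wcol innerE tr_col mulmxA -row_mul.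
  by rewrite colE mulmxA -colE -row_mul !mxE.
rewrite innerE mulmx_suml mulmx_sumr summxE; apply: eq_bigr => i _.
by rewrite !wE innerE trmx_mul !mulmxA.
Qed.

Lemma to_so_wedge x y u :
  to_so (wedge x y) *m u = inner x u *: y - inner y u *: x.
Proof.
have -> : to_so (wedge x y) = y *m x^T - x *m y^T.
  apply/matrixP; apply: all4; apply: all4;
  rewrite /to_so sum6 !mxE !big_ord1 !mxE !iloE !ihiE /=; ring.
rewrite mulmxBl -!mulmxA; congr (_ - _); apply/colP => i;
by rewrite !mxE big_ord1 innerE mxE mulrC; congr (_ * _); rewrite mxE;
   apply: eq_bigr => j _; rewrite mulrC !mxE.
Qed.

Lemma to_soK : cancel (@to_so R) (@of_so R).
Proof.
move=> eta; apply/colP; apply: all6;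
by rewrite !mxE /to_so sum6 !mxE !iloE !ihiE /=; ring.
Qed.

Lemma of_soK A : A^T = - A -> to_so (of_so A) = A.
Proof.
move=> skA.
have AN i j : A i j = - A j i by move/matrixP/(_ j i): skA; rewrite !mxE.
have A0 i : A i i = 0 by have := AN i i; lra.
apply/matrixP; apply: all4; apply: all4;
rewrite /to_so sum6 !mxE !iloE !ihiE /= ?A0; try ring.
all: by rewrite [RHS]AN; ring.
Qed.

Lemma innerD n (u v w : 'cV[R]_n) : inner (u + v) w = inner u w + inner v w.
Proof. by rewrite /inner -big_split; apply: eq_bigr => i _;
   rewrite mxE mulrDl. Qed.

Lemma innerZ n a (u w : 'cV[R]_n) : inner (a *: u) w = a * inner u w.
Proof. by rewrite /inner mulr_sumr; apply: eq_bigr => i _;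
   rewrite mxE mulrA. Qed.

Lemma inner_tr n (M : 'M[R]_n) u v : inner (M *m u) v = inner (M^T *m v) u.
Proof.
rewrite !innerE (_ : (v^T *m (M *m u)) 0 0 = (v^T *m (M *m u))^T 0 0).
  by rewrite !trmx_mul trmxK mulmxA.
by rewrite [RHS]mxE.
Qed.

Lemma to_soD a eta zeta : to_so (a *: eta + zeta) = a *: to_so eta + to_so zeta.
Proof.
rewrite /to_so scaler_sumr -big_split; apply: eq_bigr => k _ /=.
by rewrite !mxE scalerDl scalerA.
Qed.

Lemma of_soD a A B : of_so (a *: A + B) = a *: of_so A + of_so B.
Proof. by apply/colP => k; rewrite !mxE. Qed.

Lemma bracketDl a eta eta' zeta :
  bracket (a *: eta + eta') zeta = a *: bracket eta zeta + bracket eta' zeta.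
Proof.
rewrite /bracket -of_soD to_soD mulmxDl mulmxDr -scalemxAl -scalemxAr.
by rewrite scalerBr opprD addrACA.
Qed.

Lemma bracketDr a eta zeta zeta' :
  bracket eta (a *: zeta + zeta') = a *: bracket eta zeta + bracket eta zeta'.
Proof.
rewrite /bracket -of_soD to_soD mulmxDl mulmxDr -scalemxAl -scalemxAr.
by rewrite scalerBr opprD addrACA.
Qed.

Definition sharp_bil Rm eta zeta : R := - 2^-1 *
  \sum_i inner (bracket eta (Rm *m bracket zeta (Rm *m ebase R i))) (ebase R i).

Lemma sharp_bilDl Rm a eta eta' zeta : sharp_bil Rm (a *: eta + eta') zeta =
  a * sharp_bil Rm eta zeta + sharp_bil Rm eta' zeta.
Proof.
rewrite /sharp_bil mulrCA -mulrDr; congr (_ * _).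
rewrite mulr_sumr -big_split; apply: eq_bigr => i _ /=.
by rewrite bracketDl innerD innerZ.
Qed.

Lemma sharp_bilDr Rm a eta zeta zeta' : sharp_bil Rm eta (a *: zeta + zeta') =
  a * sharp_bil Rm eta zeta + sharp_bil Rm eta zeta'.
Proof.
rewrite /sharp_bil mulrCA -mulrDr; congr (_ * _).
rewrite mulr_sumr -big_split; apply: eq_bigr => i _ /=.
by rewrite bracketDl mulmxDr -scalemxAr bracketDr innerD innerZ.
Qed.

Lemma sharpE Rm k l : sharp Rm k l = 2^-1 *
  (sharp_bil Rm (ebase R k) (ebase R l) + sharp_bil Rm (ebase R l) (ebase R k)).
Proof.
have D u v : sharp_form Rm (u + v) - sharp_form Rm u - sharp_form Rm v =
    sharp_bil Rm u v + sharp_bil Rm v u.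
  have F w : sharp_form Rm w = sharp_bil Rm w w by [].
  have Dl w : sharp_bil Rm (u + v) w = sharp_bil Rm u w + sharp_bil Rm v w.
    by rewrite -[u in LHS]scale1r sharp_bilDl mul1r.
  have Dr w : sharp_bil Rm w (u + v) = sharp_bil Rm w u + sharp_bil Rm w v.
    by rewrite -[u in LHS]scale1r sharp_bilDr mul1r.
  rewrite !F Dl !Dr.
  move: (sharp_bil Rm u u) (sharp_bil Rm v v) => p q.
  by move: (sharp_bil Rm u v) (sharp_bil Rm v u) => r s; ring.
by rewrite mxE D.
Qed.

Lemma sharp_sym Rm : (sharp Rm)^T = sharp Rm.
Proof. by apply/matrixP => k l; rewrite mxE !sharpE addrC. Qed.

Lemma inner_sharp Rm eta : inner (sharp Rm *m eta) eta = sharp_form Rm eta.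
Proof.
have etaE : eta = \sum_k eta k 0 *: ebase R k.
  apply/colP => i; rewrite summxE (bigD1 i) //= big1 => [|j ji].
    by rewrite !mxE !eqxx mulr1 addr0.
  by rewrite !mxE eq_sym (negPf ji) mulr0.
have suml (F : 'I_6 -> 'cV[R]_6) w (c : 'I_6 -> R) :
    sharp_bil Rm (\sum_k c k *: F k) w = \sum_k c k * sharp_bil Rm (F k) w.
  elim/big_rec2: _ => [|k p q _ <-]; last exact: sharp_bilDl.
  have := sharp_bilDl Rm 1 0 0 w; rewrite scale1r addr0 mul1r.
  by move: (sharp_bil _ _ _) => p; lra.
have sumr (F : 'I_6 -> 'cV[R]_6) w (c : 'I_6 -> R) :
    sharp_bil Rm w (\sum_k c k *: F k) = \sum_k c k * sharp_bil Rm w (F k).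
  elim/big_rec2: _ => [|k p q _ <-]; last exact: sharp_bilDr.
  have := sharp_bilDr Rm 1 w 0 0; rewrite scale1r addr0 mul1r.
  by move: (sharp_bil _ _ _) => p; lra.
have -> : sharp_form Rm eta = sharp_bil Rm (\sum_k eta k 0 *: ebase R k)
    (\sum_k eta k 0 *: ebase R k) by rewrite -etaE.
rewrite suml.
under [RHS]eq_bigr do rewrite sumr mulr_sumr.
rewrite /inner.
under [LHS]eq_bigr do rewrite mxE mulr_suml.
pose S := \sum_k \sum_l
  eta k 0 * (eta l 0 * sharp_bil Rm (ebase R k) (ebase R l)).
rewrite -/S.
have SE : S = \sum_k \sum_l
  eta k 0 * (eta l 0 * sharp_bil Rm (ebase R l) (ebase R k)).
  rewrite /S exchange_big; apply: eq_bigr => k _; apply: eq_bigr => l _ /=.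
  by rewrite mulrCA.
have -> : S = 2^-1 * (S + S) by field.
rewrite {2}SE /S -big_split mulr_sumr; apply: eq_bigr => k _ /=.
rewrite -big_split mulr_sumr; apply: eq_bigr => l _ /=.
rewrite sharpE; move: (sharp_bil _ _ _) (sharp_bil _ _ _) => p q.
by ring.
Qed.

Lemma sharp_unique Rm S : S^T = S ->
  (forall eta, inner (S *m eta) eta = sharp_form Rm eta) -> S = sharp Rm.
Proof.
move=> symS SE; apply/matrixP => k l; rewrite mxE -!SE.
have bE (i j : 'I_6) : inner (S *m ebase R i) (ebase R j) = S j i.
  by rewrite inner_ebase mul_ebase mxE.
have iD (u v w z : 'cV[R]_6) : inner (u + v) (w + z) =
    inner u w + inner u z + inner v w + inner v z.
  rewrite /inner -!big_split; apply: eq_bigr => i _ /=.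
  by rewrite !mxE; ring.
have Skl : S k l = S l k by rewrite -{1}symS mxE.
by rewrite mulmxDr iD !bE Skl; field.
Qed.

Lemma curv_opD a Rm Rm' :
  curv_op Rm -> curv_op Rm' -> curv_op (a *: Rm + Rm').
Proof.
move=> [sR bR] [sR' bR']; split; first by rewrite linearD linearZ /= sR sR'.
move=> x y z t; pose b (M : 'M[R]_6) := inner (M *m wedge x y) (wedge z t)
  + inner (M *m wedge z x) (wedge y t) + inner (M *m wedge y z) (wedge x t).
have bD : b (a *: Rm + Rm') = a * b Rm + b Rm'.
  by rewrite /b !mulmxDl -!scalemxAl !innerD !innerZ; ring.
by rewrite -/(b _) bD /b bR bR' mulr0 addr0.
Qed.

Lemma ricciD a Rm Rm' : ricci (a *: Rm + Rm') = a *: ricci Rm + ricci Rm'.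
Proof.
apply/matrixP => i j; rewrite !mxE mulr_sumr -big_split; apply: eq_bigr => k _.
by rewrite !mulmxDl -!scalemxAl !innerD !innerZ.
Qed.

Lemma curv_op1 : curv_op (1%:M : 'M[R]_6).
Proof.
split; first exact: trmx1.
by move=> x y z t; rewrite !mul1mx !inner_wedge /inner !sum4; ring.
Qed.

Lemma curv_op_wedge A : A^T = A -> curv_op (wedge_op A 1%:M).
Proof.
move=> symA; split.
  apply/matrixP => k l; rewrite mxE !wedge_opE.
  have AE i j : A i j = A j i by rewrite -{1}symA mxE.
  rewrite !(AE _ (ilo k)) !(AE _ (ihi k)) !mxE !(eq_sym _ (ilo k)).
  by rewrite !(eq_sym _ (ihi k)); ring.
move=> x y z t.
have iA u v : inner (A *m u) v = inner (A *m v) u.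
  by rewrite inner_tr symA.
rewrite !wedge_op_wedge !mul1mx !innerZ !innerD !inner_wedge.
have iC (u v : 'cV[R]_4) : inner u v = inner v u.
  by rewrite /inner; apply: eq_bigr => i _; rewrite mulrC.
rewrite (iA y x) (iA z x) (iA z y).
rewrite (iC y x) (iC z x) (iC z y).
by ring.
Qed.

Lemma ricci1 : ricci (1%:M : 'M[R]_6) = 3 *: 1%:M.
Proof.
apply/matrixP => a b; rewrite !mxE.
under eq_bigr do rewrite mul1mx inner_wedge !inner_ebase !mxE eqxx.
by move: a b; apply: all4; apply: all4; rewrite sum4 /=; ring.
Qed.

Lemma ricci_wedge A : \tr A = 0 -> ricci (wedge_op A 1%:M) = A.
Proof.
rewrite /mxtrace sum4 => trA; apply/matrixP => a b; rewrite mxE.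
under eq_bigr do rewrite wedge_op_wedge !mul1mx innerZ innerD !inner_wedge
  !inner_ebase !mul_ebase !mxE !eqxx.
by move: a b; apply: all4; apply: all4; rewrite sum4 /=; lra.
Qed.

Lemma tr_ricci Rm : \tr (ricci Rm) = scal Rm.
Proof.
rewrite /scal /mxtrace !sum4 !sum6 !mxE !sum4.
pose e (a b : 'I_4) := wedge (ebase R a) (ebase R b).
have eE (a b : 'I_4) : wedge (ebase R a) (ebase R b) = e a b by [].
have e0 a : e a a = 0 by apply/colP => k; rewrite !mxE mulrC subrr.
have eN a b : e a b = - e b a by apply/colP => k; rewrite !mxE; ring.
have eB k : e (ilo k) (ihi k) = ebase R k.
  apply/colP; move: k; apply: all6; apply: all6;
  by rewrite !mxE ?iloE ?ihiE /=; ring.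
have iN (u v : 'cV[R]_6) : inner (Rm *m - u) (- v) = inner (Rm *m u) v.
  by rewrite mulmxN /inner; apply: eq_bigr => i _; rewrite !mxE mulrNN.
have i0 : inner (Rm *m 0) 0 = 0.
  by rewrite mulmx0 /inner big1 // => i _; rewrite mxE mul0r.
have iB k : inner (Rm *m ebase R k) (ebase R k) = Rm k k.
  by rewrite inner_ebase mul_ebase mxE.
rewrite !eE !e0 !i0 (eN 1 0) (eN 2 0) (eN 3 0) (eN 2 1) (eN 3 1) (eN 3 2) !iN.
have := eB 0; have := eB 1; have := eB 2; have := eB 3; have := eB 4.
have := eB 5; rewrite !iloE !ihiE => -> -> -> -> -> ->.
by rewrite !iB; ring.
Qed.

Lemma weylP Rm : curv_op Rm -> is_weyl_component Rm (weyl Rm).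
Proof.
move=> cRm; pose c := scal Rm / 12; pose A := ricci Rm - (3 * c)%:M.
have symA : A^T = A.
  rewrite /A linearB /= tr_scalar_mx; congr (_ - _).
  apply/matrixP => a b; rewrite !mxE; apply: eq_bigr => i _.
  by rewrite inner_tr cRm.1.
have trA : \tr A = 0.
  by rewrite /A linearB /= tr_ricci mxtrace_scalar /c; field.
pose W := - c *: 1%:M + (- 1 *: wedge_op A 1%:M + Rm).
suff : is_weyl_component Rm W by exact: getI.
split; first split.
- apply: curv_opD; first exact: curv_op1.
  by apply: curv_opD => //; exact: curv_op_wedge.
- rewrite !ricciD ricci1 ricci_wedge // scaleN1r /A -scalemx1 scalerA.
  by apply/matrixP => a b; rewrite !mxE; ring.
- exists c, (wedge_op A 1%:M); first by exists A.
  rewrite /W; move: (wedge_op A 1%:M) => S.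
  by apply/matrixP => a b; rewrite !mxE; ring.
Qed.

Lemma weyl_unique Rm W W' :
  is_weyl_component Rm W -> is_weyl_component Rm W' -> W = W'.
Proof.
suff WE V : is_weyl_component Rm V ->
    V = Rm - (\tr (ricci Rm) / 12) *: 1%:M
        - wedge_op (ricci Rm - (\tr (ricci Rm) / 4) *: 1%:M) 1%:M.
  by move=> /WE -> /WE ->.
move=> [[_ ricV] [c [_ [A [symA trA] <-] RmE]]].
have rE : ricci Rm = (3 * c) *: 1%:M + A.
  rewrite RmE -[wedge_op _ _]scale1r -addrA !ricciD ricV ricci1 ricci_wedge //.
  by rewrite scale1r addr0 scalerA mulrC.
have tE : \tr (ricci Rm) = 12 * c.
  by rewrite rE linearD linearZ /= mxtrace1 trA; ring.
have -> : ricci Rm - (\tr (ricci Rm) / 4) *: 1%:M = A.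
  rewrite tE rE (_ : 12 * c / 4 = 3 * c); last by field.
  by rewrite addrAC subrr add0r.
rewrite tE (_ : 12 * c / 12 = c); last by field.
rewrite RmE; move: (wedge_op A 1%:M) => S.
by apply/matrixP => a b; rewrite !mxE; ring.
Qed.

End Characterizations.

(* Main.v *)
(* Let [H] be the Hodge star of Lambda^2 R^4. It is symmetric, [H^2 = 1], and its
   eigenspaces are the two ideals of so(4), so it commutes with every [ad eta].
   On curvature operators, Rm |-> Scal/12 I + W is the projection
   [P = (Rm + H Rm H) / 2] onto the part commuting with [H]; the remainder [S],
   which anticommutes with [H], is the traceless Ricci part. Since the sharp of
   [P + S] has no cross term and the sharp of [S] anticommutes with [H], the
   projection of Q(Rm) is Q(P) + S^2. Here S^2 is a nonnegative curvature operator
   and so belongs to the given cone: hence the projection of Q(Rm) is tangent to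
   that cone at [P]. As the identity is interior to the cone, tangency persists in
   the subspace fixed by the projection, which gives the invariance of the
   preimage of the cone. *)

Require Import Defs.
From mathcomp Require Import all_boot all_order all_algebra.
From mathcomp Require Import ring lra.
From mathcomp Require Import all_classical all_reals all_analysis.
Import Order.TTheory GRing.Theory Num.Theory.
Import numFieldNormedType.Exports.
Local Open Scope classical_set_scope.
Local Open Scope ring_scope.

(** * The Hodge star, the Bianchi identity and the bracket of so(4) *)

Section HodgeStar.
Set Implicit Arguments.
Unset Strict Implicit.
Variable R : realType.
Implicit Types (x y z t : 'cV[R]_4) (eta zeta : 'cV[R]_6).
Implicit Types (g A B : 'M[R]_4) (X Y : 'M[R]_6).

(** The sign of the permutation listing [ilo k], [ihi k] and then the two complementary indices in
    increasing order. *)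
Definition hodge_sgn (k : 'I_6) : R := [:: 1; -1; 1; 1; -1; 1]`_k.

(* The Hodge star pairs e_(ilo k) /\ e_(ihi k) with the basis vector of the
   complementary indices, which is at position [rev_ord k]. *)
Definition hodge : 'M[R]_6 :=
  \matrix_(k, l) (if l == rev_ord k then hodge_sgn k else 0).

Lemma rev_ordE : (@rev_ord 6 0 = 5) * (@rev_ord 6 1 = 4) * (@rev_ord 6 2 = 3) *
  (@rev_ord 6 3 = 2) * (@rev_ord 6 4 = 1) * (@rev_ord 6 5 = 0).
Proof. by do !split; apply/val_inj. Qed.

Lemma hodge_sgnE : (hodge_sgn 0 = 1) * (hodge_sgn 1 = -1) * (hodge_sgn 2 = 1) *
  (hodge_sgn 3 = 1) * (hodge_sgn 4 = -1) * (hodge_sgn 5 = 1).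
Proof. by []. Qed.

Lemma hodge_mull n (M : 'M[R]_(6, n)) k l :
  (hodge *m M) k l = hodge_sgn k * M (rev_ord k) l.
Proof.
rewrite mxE (bigD1 (rev_ord k)) //= big1 ?addr0 => [|j jk]; rewrite mxE.
  by rewrite eqxx.
by rewrite (negPf jk) mul0r.
Qed.

Lemma tr_hodge : hodge^T = hodge.
Proof.
apply/matrixP; apply: all6; apply: all6;
by rewrite !mxE !rev_ordE !hodge_sgnE.
Qed.

Lemma hodgeK : hodge *m hodge = 1%:M.
Proof.
apply/matrixP; apply: all6; apply: all6;
by rewrite hodge_mull !mxE !rev_ordE !hodge_sgnE /=; ring.
Qed.

Lemma hodge_conj k l X :
  (hodge *m X *m hodge) k l =
  hodge_sgn k * hodge_sgn l * X (rev_ord k) (rev_ord l).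
Proof.
rewrite -[hodge *m X *m hodge]trmxK mxE trmx_mul tr_hodge hodge_mull mxE.
by rewrite hodge_mull; ring.
Qed.

Lemma mxtrace_hodge X :
  X^T = X -> \tr (hodge *m X) = 2 * (X 0 5 - X 1 4 + X 2 3).
Proof.
move=> symX; have XE i j : X i j = X j i by rewrite -{1}symX mxE.
rewrite /mxtrace sum6 !hodge_mull !rev_ordE !hodge_sgnE.
by rewrite (XE 5 0) (XE 4 1) (XE 3 2); ring.
Qed.

(** For symmetric [X] the cyclic sum is alternating in its four arguments, hence in dimension 4 a
    multiple of the volume form; the coefficient is half of this trace. *)
Lemma bianchiP X : X^T = X -> bianchi X <-> \tr (hodge *m X) = 0.
Proof.
move=> symX; have XE i j : X i j = X j i by rewrite -{1}symX mxE.
rewrite mxtrace_hodge //; split.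
  move/(_ (ebase R 0) (ebase R 1) (ebase R 2) (ebase R 3)).
  have e01 : wedge (ebase R 0) (ebase R 1) = ebase R 0.
    by apply/colP; apply: all6; rewrite !mxE !iloE !ihiE /=; ring.
  have e20 : wedge (ebase R 2) (ebase R 0) = - ebase R 1.
    by apply/colP; apply: all6; rewrite !mxE !iloE !ihiE /=; ring.
  have e12 : wedge (ebase R 1) (ebase R 2) = ebase R 3.
    by apply/colP; apply: all6; rewrite !mxE !iloE !ihiE /=; ring.
  have e23 : wedge (ebase R 2) (ebase R 3) = ebase R 5.
    by apply/colP; apply: all6; rewrite !mxE !iloE !ihiE /=; ring.
  have e13 : wedge (ebase R 1) (ebase R 3) = ebase R 4.
    by apply/colP; apply: all6; rewrite !mxE !iloE !ihiE /=; ring.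
  have e03 : wedge (ebase R 0) (ebase R 3) = ebase R 2.
    by apply/colP; apply: all6; rewrite !mxE !iloE !ihiE /=; ring.
  rewrite e01 e20 e12 e23 e13 e03 mulmxN !mul_ebase !inner_ebase !mxE.
  by rewrite (XE 5 0) (XE 4 1); lra.
move=> X0 x y z t.
have -> : inner (X *m wedge x y) (wedge z t) + inner (X *m wedge z x) (wedge y t)
    + inner (X *m wedge y z) (wedge x t)
    = (X 0 5 - X 1 4 + X 2 3) * inner (wedge x y) (hodge *m wedge z t).
  rewrite /inner !sum6 !hodge_mull !rev_ordE !hodge_sgnE !mxE !sum6 !mxE.
  rewrite !iloE !ihiE.
  rewrite !(XE 1 0) !(XE 2 0) !(XE 3 0) !(XE 4 0) !(XE 5 0) !(XE 2 1) !(XE 3 1).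
  rewrite !(XE 4 1) !(XE 5 1) !(XE 3 2) !(XE 4 2) !(XE 5 2) !(XE 4 3) !(XE 5 3).
  by rewrite !(XE 5 4); ring.
have -> : X 0 5 - X 1 4 + X 2 3 = 0 by lra.
by rewrite mul0r.
Qed.

Lemma curv_opP X : curv_op X <-> X^T = X /\ \tr (hodge *m X) = 0.
Proof. by split=> -[symX]; move/(bianchiP symX) => ?; split. Qed.

Definition ad eta : 'M[R]_6 := \matrix_(i, j) bracket eta (ebase R j) i 0.

Lemma bracket_ad eta zeta : bracket eta zeta = ad eta *m zeta.
Proof.
have zE : zeta = \sum_k zeta k 0 *: ebase R k.
  apply/colP => i; rewrite summxE (bigD1 i) //= big1 => [|j ji].
    by rewrite !mxE !eqxx mulr1 addr0.
  by rewrite !mxE eq_sym (negPf ji) mulr0.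
have b0 : bracket eta 0 = 0.
  have := bracketDr (-1) eta 0 0; rewrite scaler0 addr0 scaleN1r addNr.
  by [].
rewrite [in LHS]zE.
have -> : bracket eta (\sum_k zeta k 0 *: ebase R k) =
    \sum_k zeta k 0 *: bracket eta (ebase R k).
  apply: (big_ind2 (fun u v => bracket eta u = v)) => // [u u' v v' <- <-|k _].
    by rewrite -[u in LHS]scale1r bracketDr scale1r.
  by rewrite -[_ *: _ in LHS]addr0 bracketDr b0 addr0.
apply/colP => i; rewrite summxE [RHS]mxE; apply: eq_bigr => k _.
by rewrite [LHS]mxE [ad _ _ _]mxE mulrC.
Qed.

Lemma to_soE eta :
  (to_so eta 0 0 = 0) * (to_so eta 0 1 = - eta 0 0) *
  (to_so eta 0 2 = - eta 1 0) * (to_so eta 0 3 = - eta 2 0) *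
  (to_so eta 1 0 = eta 0 0) * (to_so eta 1 1 = 0) *
  (to_so eta 1 2 = - eta 3 0) * (to_so eta 1 3 = - eta 4 0) *
  (to_so eta 2 0 = eta 1 0) * (to_so eta 2 1 = eta 3 0) *
  (to_so eta 2 2 = 0) * (to_so eta 2 3 = - eta 5 0) *
  (to_so eta 3 0 = eta 2 0) * (to_so eta 3 1 = eta 4 0) *
  (to_so eta 3 2 = eta 5 0) * (to_so eta 3 3 = 0).
Proof. by do !split; rewrite /to_so sum6 !mxE !iloE !ihiE /=; ring. Qed.

(** The infinitesimal form of the SO(4)-equivariance of the star, checked here in coordinates. *)
Lemma hodge_bracket eta zeta :
  hodge *m bracket eta zeta = bracket eta (hodge *m zeta).
Proof.
apply/colP; apply: all6; rewrite hodge_mull !rev_ordE !hodge_sgnE !mxE !sum4;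
rewrite !iloE !ihiE !to_soE !hodge_mull !rev_ordE !hodge_sgnE.
all: by ring.
Qed.

Lemma bracketC eta zeta : bracket zeta eta = - bracket eta zeta.
Proof. by apply/colP => k; rewrite !mxE opprB. Qed.

End HodgeStar.

Arguments hodge {R}.

(** * Even and odd parts under conjugation by [hodge], and the splitting of [Qfield] *)

Section BlockDiagonal.
Set Implicit Arguments.
Unset Strict Implicit.
Variable R : realType.
Implicit Types (eta zeta : 'cV[R]_6) (g A B : 'M[R]_4) (X Y P S : 'M[R]_6).

Lemma hodge_ad eta : hodge *m ad eta = ad eta *m hodge.
Proof.
apply/matrixP => i j.
have /matrixP/(_ i 0) : hodge *m ad eta *m ebase R j =
    ad eta *m hodge *m ebase R j.
  by rewrite -!mulmxA -!bracket_ad hodge_bracket.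
by rewrite !mul_ebase ![col _ _ _ _]mxE.
Qed.

(** Antisymmetry of the bracket carries [hodge_bracket] over to the first argument. *)
Lemma ad_hodge eta : ad (hodge *m eta) = hodge *m ad eta.
Proof.
apply/matrixP => i j.
have /matrixP/(_ i 0) : ad (hodge *m eta) *m ebase R j =
    hodge *m ad eta *m ebase R j.
  rewrite -mulmxA -!bracket_ad bracketC -hodge_bracket.
  by rewrite (bracketC eta) mulmxN opprK.
by rewrite !mul_ebase ![col _ _ _ _]mxE.
Qed.

(** As a trace, the form is open to cyclicity and to the commutation of [hodge] with [ad eta]. *)
Lemma sharp_formE X eta :
  sharp_form X eta = - 2^-1 * \tr (ad eta *m X *m ad eta *m X).
Proof.
congr (_ * _); apply: eq_bigr => i _.
by rewrite !bracket_ad !mulmxA mul_ebase inner_ebase mxE.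
Qed.

Lemma sym_form_inj n (X Y : 'M[R]_n) : X^T = X -> Y^T = Y ->
  (forall u, inner (X *m u) u = inner (Y *m u) u) -> X = Y.
Proof.
move=> symX symY XY; apply/matrixP => k l.
have E (Z : 'M[R]_n) : Z^T = Z -> Z k l = 2^-1 *
    (inner (Z *m (ebase R k + ebase R l)) (ebase R k + ebase R l)
     - inner (Z *m ebase R k) (ebase R k) - inner (Z *m ebase R l) (ebase R l)).
  move=> symZ; have ZE i j : Z i j = Z j i by rewrite -{1}symZ mxE.
  have innerDr (u v w : 'cV[R]_n) : inner u (v + w) = inner u v + inner u w.
    by rewrite !innerE linearD mulmxDl mxE.
  rewrite mulmxDr innerD !innerDr !inner_ebase !mul_ebase !mxE (ZE l k).
  by field.
by rewrite (E X) // (E Y) // !XY.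
Qed.

Lemma inner_sharp_tr X eta : inner (sharp X *m eta) eta =
  - 2^-1 * \tr (ad eta *m X *m ad eta *m X).
Proof. by rewrite inner_sharp sharp_formE. Qed.

(** Replacing [eta] by [hodge *m eta] conjugates only one of the two copies of [X] in the trace, so
    the factor is [c] although sharp is quadratic. *)
Lemma sharp_conj_hodge c X : hodge *m X *m hodge = c *: X ->
  hodge *m sharp X *m hodge = c *: sharp X.
Proof.
move=> XE.
have form_hodge eta : sharp_form X (hodge *m eta) = c * sharp_form X eta.
  rewrite !sharp_formE ad_hodge mulrCA; congr (_ * _).
  have -> : hodge *m ad eta *m X *m (hodge *m ad eta) *m X =
      ad eta *m (hodge *m X *m hodge) *m ad eta *m X.
    by rewrite {1}hodge_ad !mulmxA.
  by rewrite XE -!scalemxAr -!scalemxAl mxtraceZ.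
apply: sym_form_inj => [||eta].
- by rewrite !trmx_mul tr_hodge sharp_sym mulmxA.
- by rewrite linearZ /= sharp_sym.
by rewrite -scalemxAl innerZ inner_sharp -form_hodge -inner_sharp !innerE
  trmx_mul tr_hodge !mulmxA.
Qed.

Lemma sharpD_hodge P S : hodge *m P *m hodge = P -> hodge *m S *m hodge = - S ->
  sharp (P + S) = sharp P + sharp S.
Proof.
move=> HP HS.
(* Abstracting [sharp] prevents unification from unfolding it. *)
move: (@sharp R) (@sharp_sym R) inner_sharp_tr => sharp' sharp'_sym formE.
apply: sym_form_inj => [||eta]; first exact: sharp'_sym.
  by rewrite raddfD /= !sharp'_sym.
rewrite mulmxDl innerD !formE.
(* Conjugation by [hodge] fixes [P] and commutes with [ad eta]; cyclicity moves it onto [S], where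
   it changes the sign. *)
have cross : \tr (ad eta *m P *m ad eta *m S) = 0.
  suff : \tr (ad eta *m P *m ad eta *m S) = - \tr (ad eta *m P *m ad eta *m S).
    by move: (\tr _) => a; lra.
  transitivity (\tr (hodge *m (ad eta *m P *m ad eta *m hodge *m S))).
    rewrite -{1}HP !mulmxA -hodge_ad -!mulmxA.
    by rewrite (mulmxA hodge (ad eta) S) hodge_ad !mulmxA.
  by rewrite mxtrace_mulC -raddfN -mulmxN -HS /= !mulmxA.
have crossC : \tr (ad eta *m S *m ad eta *m P) = 0.
  by rewrite -mulmxA mxtrace_mulC mulmxA cross.
rewrite !(mulmxDl, mulmxDr) !mxtraceD cross crossC.
by ring.
Qed.

(* The block-diagonal part with respect to the eigenspaces of [hodge]; on
   curvature operators it is Scal/12 I + W (see [scal_weylE]). *)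
Definition blockdiag X : 'M[R]_6 := 2^-1 *: (X + hodge *m X *m hodge).

Lemma hodge_conjK X : hodge *m (hodge *m X *m hodge) *m hodge = X.
Proof. by rewrite !mulmxA hodgeK mul1mx -mulmxA hodgeK mulmx1. Qed.

Lemma hodge_blockdiag X : hodge *m blockdiag X *m hodge = blockdiag X.
Proof.
rewrite /blockdiag -scalemxAr -scalemxAl mulmxDr mulmxDl; congr (_ *: _).
by rewrite hodge_conjK addrC.
Qed.

Lemma hodge_blockdiagC X :
  hodge *m (X - blockdiag X) *m hodge = - (X - blockdiag X).
Proof.
rewrite mulmxBr mulmxBl hodge_blockdiag /blockdiag.
by move: (hodge *m X *m hodge) => Y; apply/matrixP => i j; rewrite !mxE; field.
Qed.

Lemma blockdiag_even X : hodge *m X *m hodge = X -> blockdiag X = X.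
Proof.
by move=> HX; rewrite /blockdiag HX; apply/matrixP=> i j; rewrite !mxE; field.
Qed.

Lemma blockdiag_odd X : hodge *m X *m hodge = - X -> blockdiag X = 0.
Proof. by move=> HX; rewrite /blockdiag HX subrr scaler0. Qed.

Lemma blockdiagD a X Y :
  blockdiag (a *: X + Y) = a *: blockdiag X + blockdiag Y.
Proof.
rewrite /blockdiag mulmxDr mulmxDl -scalemxAr -scalemxAl.
move: (hodge *m X *m hodge) (hodge *m Y *m hodge) => X' Y'.
by apply/matrixP => i j; rewrite !mxE; ring.
Qed.

Lemma hodge_conjM X Y : hodge *m (X *m Y) *m hodge =
  (hodge *m X *m hodge) *m (hodge *m Y *m hodge).
Proof. by rewrite -!mulmxA (mulmxA hodge hodge) hodgeK mul1mx. Qed.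

Lemma tr_hodge_odd X : hodge *m X *m hodge = - X -> \tr (hodge *m X) = 0.
Proof.
move=> HX; have : \tr (hodge *m (hodge *m X *m hodge)) = - \tr (hodge *m X).
  by rewrite HX mulmxN raddfN.
rewrite !mulmxA hodgeK mul1mx mxtrace_mulC.
by move: (\tr _) => a; lra.
Qed.

(** [S] anticommutes with [hodge], so cyclicity equates the trace with its opposite. Through
    [curv_opP] this yields the Bianchi identity for the square of a symmetric odd [S]. *)
Lemma tr_hodge_odd_sqr S :
  hodge *m S *m hodge = - S -> \tr (hodge *m (S *m S)) = 0.
Proof.
move=> HS; have HSE : hodge *m S = - (S *m hodge).
  rewrite -[S *m hodge]mul1mx -hodgeK -mulmxA (mulmxA hodge S) HS.
  by rewrite mulmxN opprK.
have : \tr (hodge *m (S *m S)) = - \tr (hodge *m (S *m S)).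
  by rewrite {1}mulmxA HSE mulNmx raddfN /= -mulmxA mxtrace_mulC mulmxA.
by move: (\tr _) => a; lra.
Qed.

(** The last parenthesis collects the odd terms; the terms before it are even. *)
Lemma QfieldD_hodge P S : hodge *m P *m hodge = P -> hodge *m S *m hodge = - S ->
  Qfield (P + S) = Qfield P + S *m S + (P *m S + S *m P + sharp S).
Proof.
move=> HP HS; rewrite /Qfield sharpD_hodge // mulmxDl !mulmxDr.
move: (P *m P) (P *m S) (S *m P) (S *m S) (sharp P) (sharp S) => a b c d e f.
by apply/matrixP => i j; rewrite !mxE; ring.
Qed.

Lemma Qfield_cross_odd P S : hodge *m P *m hodge = P -> hodge *m S *m hodge = - S ->
  hodge *m (P *m S + S *m P + sharp S) *m hodge = - (P *m S + S *m P + sharp S).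
Proof.
move=> HP HS.
have := @sharp_conj_hodge (-1) S; rewrite !scaleN1r => /(_ HS) Hsharp.
by rewrite !mulmxDr !mulmxDl Hsharp !hodge_conjM HP HS !opprD mulmxN mulNmx.
Qed.

Lemma Qfield_even P : hodge *m P *m hodge = P ->
  hodge *m Qfield P *m hodge = Qfield P.
Proof.
move=> HP; have := @sharp_conj_hodge 1 P; rewrite !scale1r => /(_ HP) Hsharp.
by rewrite /Qfield mulmxDr mulmxDl hodge_conjM HP Hsharp.
Qed.

Lemma blockdiag_Qfield X : blockdiag (Qfield X) =
  Qfield (blockdiag X) + (X - blockdiag X) *m (X - blockdiag X).
Proof.
set P := blockdiag X; set S := X - P.
have HP : hodge *m P *m hodge = P := hodge_blockdiag X.
have HS : hodge *m S *m hodge = - S := hodge_blockdiagC X.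
have -> : X = P + S by rewrite addrC subrK.
rewrite QfieldD_hodge //.
rewrite -[Qfield P + _ in LHS]scale1r blockdiagD scale1r.
rewrite (blockdiag_odd (Qfield_cross_odd HP HS)) addr0.
apply: blockdiag_even.
by rewrite mulmxDr mulmxDl Qfield_even // hodge_conjM HS mulmxN mulNmx opprK.
Qed.

(* The premise will come for free from the tangency of [Qfield (blockdiag X)] to
   a cone of curvature operators; this avoids checking the Bianchi identity for
   Q in coordinates. *)
Lemma Qfield_curv_op X : X^T = X ->
  curv_op (Qfield (blockdiag X)) -> curv_op (Qfield X).
Proof.
move=> symX /curv_opP[_ trP]; apply/curv_opP; split.
  by rewrite linearD /= trmx_mul symX sharp_sym.
have HP := hodge_blockdiag X; have HS := hodge_blockdiagC X.
rewrite -[X](subrK (blockdiag X)) addrC QfieldD_hodge //.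
have := tr_hodge_odd (Qfield_cross_odd HP HS); move: (_ + sharp _) => U trU.
move: (Qfield _) trP => V trV.
have := tr_hodge_odd_sqr HS; move: (_ *m (X - blockdiag X)) => T trT.
by rewrite !mulmxDr !mxtraceD trV trT trU !addr0.
Qed.

End BlockDiagonal.

(** * Equivariance of [blockdiag] under O(4), and parity of the curvature components *)

Section Geometry.
Set Implicit Arguments.
Unset Strict Implicit.
Variable R : realType.
Implicit Types (x y : 'cV[R]_4) (eta zeta : 'cV[R]_6).
Implicit Types (g A B : 'M[R]_4) (X Y P S W : 'M[R]_6).

Lemma wedge_ebase k : wedge (ebase R (ilo k)) (ebase R (ihi k)) = ebase R k.
Proof.
apply/colP; move: k; apply: all6; apply: all6;
by rewrite !mxE ?iloE ?ihiE /=; ring.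
Qed.

(** [wedge_op g g] is the map induced by [g] on Lambda^2. *)
Lemma oactE g X : oact g X = (wedge_op g g)^T *m X *m wedge_op g g.
Proof.
have GK i : wedge (g *m ebase R (ilo i)) (g *m ebase R (ihi i)) =
    col i (wedge_op g g).
  by apply/colP => j; rewrite [RHS]mxE wedge_opE !mul_ebase !mxE; field.
apply/matrixP => k l; rewrite mxE !GK innerE tr_col mulmxA -row_mul.
by rewrite colE mulmxA -colE -row_mul !mxE.
Qed.

Lemma oact1 g : orthogonal_mx g -> oact g 1%:M = 1%:M.
Proof.
move=> og; have innerG u v : inner (g *m u) (g *m v) = inner u v.
  by rewrite !innerE trmx_mul -!mulmxA (mulmxA g^T) og mul1mx.
apply/matrixP => k l; rewrite mxE mul1mx inner_wedge !innerG -inner_wedge.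
by rewrite !wedge_ebase inner_ebase !mxE eqxx andbT.
Qed.

Lemma oact_curv_op g X : curv_op X -> curv_op (oact g X).
Proof.
move=> [symX bX]; split; first by rewrite oactE !trmx_mul trmxK symX mulmxA.
by move=> x y z t; rewrite !oact_wedge; apply: bX.
Qed.

(* Both sides represent the pullback of the volume form by [g], and [d] is the
   determinant of [g]. *)
Lemma oact_hodge g : exists d : R, oact g hodge = d *: hodge.
Proof.
pose vol (x y z t : 'cV[R]_4) := inner (hodge *m wedge x y) (wedge z t).
have volE x y z t : vol x y z t =
    (x 2 0 * y 3 0 - x 3 0 * y 2 0) * (z 0 0 * t 1 0 - z 1 0 * t 0 0)
  - (x 1 0 * y 3 0 - x 3 0 * y 1 0) * (z 0 0 * t 2 0 - z 2 0 * t 0 0)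
  + (x 1 0 * y 2 0 - x 2 0 * y 1 0) * (z 0 0 * t 3 0 - z 3 0 * t 0 0)
  + (x 0 0 * y 3 0 - x 3 0 * y 0 0) * (z 1 0 * t 2 0 - z 2 0 * t 1 0)
  - (x 0 0 * y 2 0 - x 2 0 * y 0 0) * (z 1 0 * t 3 0 - z 3 0 * t 1 0)
  + (x 0 0 * y 1 0 - x 1 0 * y 0 0) * (z 2 0 * t 3 0 - z 3 0 * t 2 0).
  rewrite /vol /inner sum6 !hodge_mull !rev_ordE !hodge_sgnE !mxE !iloE !ihiE.
  by ring.
exists (vol (col 2 g) (col 3 g) (col 0 g) (col 1 g)); apply/matrixP => k l.
rewrite [LHS]mxE !mul_ebase -/(vol _ _ _ _) [RHS]mxE [hodge _ _]mxE.
move: k l; apply: all6; apply: all6; rewrite !rev_ordE !hodge_sgnE !iloE !ihiE;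
move: (col 0 g) (col 1 g) (col 2 g) (col 3 g) => a b c d /=; rewrite !volE.
all: by ring.
Qed.

(** When [g] reverses the orientation it turns [hodge] into its opposite; [hodge] occurs twice in
    [blockdiag], so the sign cancels. *)
Lemma blockdiag_oact g X : orthogonal_mx g ->
  blockdiag (oact g X) = oact g (blockdiag X).
Proof.
move=> og; have [d] := oact_hodge g; have := oact1 og.
rewrite /blockdiag !oactE; set G := wedge_op g g; rewrite mulmx1 => GG dE.
have GGt : G *m G^T = 1%:M by apply: mulmx1C.
have dd : d * d = 1.
  have : (G^T *m hodge *m G) *m (G^T *m hodge *m G) = 1%:M.
    rewrite -!mulmxA (mulmxA G) GGt mul1mx (mulmxA hodge) hodgeK mul1mx.
    exact: GG.
  rewrite dE -scalemxAl -scalemxAr hodgeK scalerA => /matrixP/(_ 0 0).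
  by rewrite !mxE mulr1.
rewrite -scalemxAr -scalemxAl mulmxDr mulmxDl; congr (_ *: (_ + _)).
have -> : G^T *m (hodge *m X *m hodge) *m G =
    (G^T *m hodge *m G) *m (G^T *m X *m G) *m (G^T *m hodge *m G).
  by rewrite -!mulmxA !(mulmxA G G^T) !GGt !mul1mx.
by rewrite dE -!scalemxAl -!scalemxAr scalerA dd scale1r.
Qed.

(** In an eigenbasis of [A], e_i /\ e_j has eigenvalue (a_i + a_j) / 2, and the complementary plane
    has the opposite one because the trace vanishes. The proof compares entries instead. *)
Lemma wedge_op_odd A : A^T = A -> \tr A = 0 ->
  hodge *m wedge_op A 1%:M *m hodge = - wedge_op A 1%:M.
Proof.
move=> symA; rewrite /mxtrace sum4 => trA.
have AE i j : A i j = A j i by rewrite -{1}symA mxE.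
have A33 : A 3 3 = - A 0 0 - A 1 1 - A 2 2 by lra.
have AN10 := AE 1 0; have AN20 := AE 2 0; have AN30 := AE 3 0.
have AN21 := AE 2 1; have AN31 := AE 3 1; have AN32 := AE 3 2.
apply/matrixP => k l; rewrite hodge_conj [RHS]mxE !wedge_opE; move: k l.
apply: all6; apply: all6; rewrite !rev_ordE !hodge_sgnE !iloE !ihiE.
all: by rewrite ![1%:M _ _]mxE /= ?AN10 ?AN20 ?AN30 ?AN21 ?AN31 ?AN32 ?A33; ring.
Qed.

Lemma ricciE X : X^T = X ->
  (ricci X 0 0 = X 0 0 + X 1 1 + X 2 2) * (ricci X 1 1 = X 0 0 + X 3 3 + X 4 4) *
  (ricci X 2 2 = X 1 1 + X 3 3 + X 5 5) * (ricci X 3 3 = X 2 2 + X 4 4 + X 5 5) *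
  (ricci X 0 1 = X 1 3 + X 2 4) * (ricci X 0 2 = X 2 5 - X 0 3) *
  (ricci X 0 3 = - X 0 4 - X 1 5) * (ricci X 1 2 = X 0 1 + X 4 5) *
  (ricci X 1 3 = X 0 2 - X 3 5) * (ricci X 2 3 = X 1 2 + X 3 4).
Proof.
move=> symX; have XE i j : X i j = X j i by rewrite -{1}symX mxE.
pose e (a b : 'I_4) := wedge (ebase R a) (ebase R b).
have eE (a b : 'I_4) : wedge (ebase R a) (ebase R b) = e a b by [].
have e0 a : e a a = 0 by apply/colP => k; rewrite !mxE mulrC subrr.
have eN a b : e a b = - e b a by apply/colP => k; rewrite !mxE; ring.
have innerNr (u v : 'cV[R]_6) : inner u (- v) = - inner u v.
  by rewrite !innerE raddfN mulNmx mxE.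
have innerNl (u v : 'cV[R]_6) : inner (- u) v = - inner u v.
  by rewrite !innerE mulmxN mxE.
have inner0r (u : 'cV[R]_6) : inner u 0 = 0 by rewrite innerE raddf0 mul0mx mxE.
have inner0l (u : 'cV[R]_6) : inner 0 u = 0 by rewrite innerE mulmx0 mxE.
have iB k l : inner (X *m ebase R k) (ebase R l) = X l k.
  by rewrite inner_ebase mul_ebase mxE.
have := wedge_ebase 0; have := wedge_ebase 1; have := wedge_ebase 2.
have := wedge_ebase 3; have := wedge_ebase 4; have := wedge_ebase 5.
rewrite !iloE !ihiE !eE => e23 e13 e12 e03 e02 e01.
do !split; rewrite mxE sum4 !eE ?e0 ?(eN 1 0) ?(eN 2 0) ?(eN 3 0) ?(eN 2 1)
  ?(eN 3 1) ?(eN 3 2) ?e01 ?e02 ?e03 ?e12 ?e13 ?e23 ?mulmxN ?mulmx0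
  ?innerNl ?innerNr ?inner0l ?inner0r ?iB.
all: rewrite ?(XE 1 0) ?(XE 2 0) ?(XE 3 0) ?(XE 4 0) ?(XE 5 0) ?(XE 2 1).
all: rewrite ?(XE 3 1) ?(XE 4 1) ?(XE 5 1) ?(XE 3 2) ?(XE 4 2) ?(XE 5 2).
all: by rewrite ?(XE 4 3) ?(XE 5 3) ?(XE 5 4); ring.
Qed.

(** The vanishing Ricci entries identify each entry of [W] with its conjugate under [hodge]: the
    off-diagonal ones directly, the diagonal ones by combinations such as [r00 + r11 - r22 - r33],
    which gives [W 0 0 = W 5 5]. *)
Lemma weyl_even W : weyl_op W -> hodge *m W *m hodge = W.
Proof.
move=> [[symW _] /matrixP ric0].
have WE i j : W i j = W j i by rewrite -{1}symW mxE.
have [[[[[[[[[r00 r11] r22] r33] r01] r02] r03] r12] r13] r23] := ricciE symW.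
move: r00 r11 r22 r33 r01 r02 r03 r12 r13 r23; rewrite !ric0 !mxE.
move=> r00 r11 r22 r33 r01 r02 r03 r12 r13 r23.
apply/matrixP; apply: all6; apply: all6; rewrite hodge_conj !rev_ordE !hodge_sgnE.
all: rewrite ?(WE 1 0) ?(WE 2 0) ?(WE 3 0) ?(WE 4 0) ?(WE 5 0) ?(WE 2 1).
all: rewrite ?(WE 3 1) ?(WE 4 1) ?(WE 5 1) ?(WE 3 2) ?(WE 4 2) ?(WE 5 2).
all: rewrite ?(WE 4 3) ?(WE 5 3) ?(WE 5 4); lra.
Qed.

End Geometry.

(** * Closedness and continuity, and tangent directions of curvature cones *)

Section Topology.
Set Implicit Arguments.
Unset Strict Implicit.
Variable R : realType.
Implicit Types (g A : 'M[R]_4) (X Y L : 'M[R]_6) (C : set 'M[R]_6).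

Lemma scal_weylE X : curv_op X ->
  (scal X / 12) *: 1%:M + weyl X = blockdiag X.
Proof.
move=> cX; have [wW [c [_ [A [symA trA] <-] XE]]] := weylP cX.
move: (weyl X) wW XE => W wW XE.
(* Take the trace of Ricci: [c *: 1%:M] contributes [12 * c], the other two components nothing. *)
have -> : scal X / 12 = c.
  rewrite -tr_ricci XE -[wedge_op _ _]scale1r -addrA !ricciD wW.2 ricci1.
  rewrite ricci_wedge // addr0 scale1r scalerA linearD linearZ /= mxtrace1 trA.
  by field.
rewrite XE -addrA blockdiagD -[wedge_op _ _]scale1r blockdiagD.
rewrite (blockdiag_odd (wedge_op_odd symA trA)) scaler0 add0r.
rewrite (blockdiag_even (weyl_even wW)) blockdiag_even //.
by rewrite mulmx1 hodgeK.
Qed.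

Lemma blockdiag_curv_op X : curv_op X -> curv_op (blockdiag X).
Proof.
move=> /curv_opP[symX trX]; apply/curv_opP; split.
  by rewrite /blockdiag linearZ linearD /= !trmx_mul symX tr_hodge mulmxA.
rewrite /blockdiag -scalemxAr mulmxDr mxtraceZ mxtraceD trX !mulmxA hodgeK mul1mx.
by rewrite mxtrace_mulC trX addr0 mulr0.
Qed.

Lemma curv_op0 : curv_op (0 : 'M[R]_6).
Proof.
by have := curv_opD (-1) (curv_op1 R) (curv_op1 R); rewrite scaleN1r addNr.
Qed.

Lemma curv_opZ a X : curv_op X -> curv_op (a *: X).
Proof.
move=> cX; rewrite -[_ *: _]addr0; apply: curv_opD => //; exact: curv_op0.
Qed.

Lemma blockdiagZ a X : blockdiag (a *: X) = a *: blockdiag X.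
Proof.
rewrite -[a *: X]addr0 blockdiagD [blockdiag 0]blockdiag_odd ?addr0 //.
by rewrite mulmx0 mul0mx oppr0.
Qed.

Lemma mx_continuous (T : topologicalType) m n (f : T -> 'M[R]_(m, n)) :
  (forall i j, continuous (fun x => f x i j)) -> continuous f.
Proof.
move=> cf x B [V Vx VB]; apply: filterS.
  by move=> y Vy; apply: VB; exact: Vy.
apply: filter_forall => i; apply: filter_forall => j.
exact: cf (Vx i j).
Qed.

Lemma affine_continuous (T : topologicalType) (f h : T -> R) (a b c : R) :
  continuous f -> continuous h -> continuous (fun x => a + b * f x + c * h x).
Proof.
move=> cf ch x; apply: cvgD; last by apply: cvgM; [exact: cvg_cst|exact: ch].
apply: cvgD; first exact: cvg_cst.
by apply: cvgM; [exact: cvg_cst|exact: cf].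
Qed.

Lemma blockdiag_continuous : continuous (@blockdiag R).
Proof.
apply: mx_continuous => i j.
suff -> : (fun X : 'M[R]_6 => blockdiag X i j) = (fun X => 0 + 2^-1 * X i j
    + 2^-1 * (hodge_sgn R i * hodge_sgn R j) * X (rev_ord i) (rev_ord j)).
  by apply: affine_continuous; exact: coord_continuous.
apply/funext => X.
by rewrite /blockdiag [LHS]mxE [(X + _) i j]mxE hodge_conj; ring.
Qed.

Lemma closed_curv_op : closed (@curv_op R).
Proof.
move=> X clX.
have zero (f : 'M[R]_6 -> R) : continuous f ->
    (forall Y, curv_op Y -> f Y = 0) -> f X = 0.
  move=> cf f0; have : closed (f @^-1` [set 0]).
    by apply: closed_comp => [Y _|]; [exact: cf|exact: closed_eq].
  by apply => B /clX[Y [cY BY]]; exists Y; split => //; exact: f0.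
have symX : X^T = X.
  apply/matrixP => i j; rewrite mxE; apply/eqP; rewrite -subr_eq0; apply/eqP.
  have := zero _ (affine_continuous (a := 0) (b := 1) (c := -1)
    (@coord_continuous R 6 6 j i)
    (@coord_continuous R 6 6 i j)).
  rewrite add0r mul1r mulN1r; apply => Y [symY _].
  by rewrite -{1}symY mxE; ring.
apply/curv_opP; split => //; rewrite mxtrace_hodge //.
have := zero _ (affine_continuous (a := 0) (b := 1) (c := 1)
    (@coord_continuous R 6 6 0 5)
  (affine_continuous (a := 0) (b := -1) (c := 1)
    (@coord_continuous R 6 6 1 4)
    (@coord_continuous R 6 6 2 3))).
rewrite !add0r !mul1r mulN1r addrA => ->; first by rewrite mulr0.
by move=> Y /curv_opP[symY]; rewrite mxtrace_hodge // => trY; lra.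
Qed.

Lemma conv_mxE (k : {i01 R}) X Y :
  conv k (X : convex_lmodType 'M[R]_6) Y = k%:num *: X + (1 - k%:num) *: Y.
Proof. by []. Qed.

(** The sum is twice the midpoint. *)
Lemma curvature_coneD C X Y : curvature_cone C -> C X -> C Y -> C (X + Y).
Proof.
move=> [_ _ [convC coneC] _ _] CX CY.
have half_ge0 : 0 <= 2^-1 :> R by lra.
have half_le1 : 2^-1 <= 1 :> R by lra.
have := convC X Y (Itv01 half_ge0 half_le1); rewrite !inE conv_mxE /= => CXY.
have <- : 2 *: (2^-1 *: X + (1 - 2^-1) *: Y) = X + Y.
  by apply/matrixP => i j; rewrite !mxE; field.
by apply: coneC; [exact: CXY|rewrite ltr0n].
Qed.

(* As the identity is interior to the cone, moving a tangent direction slightly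
   towards it gives a direction along which one stays in the cone. *)
Lemma tangent_cone_perturb C X L (e : R) :
  curvature_cone C -> tangent_cone C X L -> 0 < e ->
  exists2 s : R, 0 < s & C (X + s *: (L + e *: 1%:M)).
Proof.
move=> coneC tL e0; have [_ _ [_ scaleC] _ [_ int1]] := coneC.
have cL : curv_op L.
  by apply: closed_curv_op => B /tL[Y [[cY _] BY]]; exists Y.
(* Chosen so that [phi L] is the identity and X + s (L + e I) = (X + s Y) + s e [phi Y]. For [Y]
   near [L], [phi Y] is close to the identity and so lies in the cone. *)
pose phi Y : 'M[R]_6 := 1%:M + e^-1 *: (L - Y).
have cphi : continuous phi.
  apply: mx_continuous => i j.
  suff -> : (fun Y : 'M[R]_6 => phi Y i j) =
      (fun Y => (1%:M i j + e^-1 * L i j) + - e^-1 * Y i j + 0 * Y i j).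
    by apply: affine_continuous; exact: coord_continuous.
  by apply/funext => Y; rewrite !mxE; ring.
have : nbhs (phi L) [set Y | curv_op Y -> C Y].
  by rewrite /phi subrr scaler0 addr0.
move=> /cphi/tL[Y [[cY [s s0 CXY]] /= Cphi]]; exists s => //.
have cphiY : curv_op (phi Y).
  rewrite /phi addrC -scaleN1r; apply: curv_opD; last exact: curv_op1.
  by rewrite addrC; apply: curv_opD.
have -> : X + s *: (L + e *: 1%:M) = (X + s *: Y) + (s * e) *: phi Y.
  rewrite /phi; apply/matrixP => i j; rewrite !mxE.
  by field; rewrite gt_eqF.
apply: curvature_coneD => //; apply: scaleC; last exact: mulr_gt0.
exact: Cphi.
Qed.

End Topology.

(** * Pulling the cone back along [blockdiag] *)

Section Preimage.
Set Implicit Arguments.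
Unset Strict Implicit.
Variable R : realType.
Implicit Types (X : 'M[R]_6) (Ct : set 'M[R]_6).

(** Used contrapositively: boundary points of the preimage project outside the interior of [Ct],
    where the invariance of [Ct] applies. *)
Lemma cinterior_blockdiag Ct X : curv_op X ->
  cinterior Ct (blockdiag X) -> cinterior [set X | curv_op X /\ Ct (blockdiag X)] X.
Proof.
move=> cX [_ intX]; split => //; have NX := blockdiag_continuous intX.
apply: (@filterS _ (nbhs X) _ _ _ _ NX) => Y CY cY; split => //.
by apply: CY; exact: blockdiag_curv_op.
Qed.

(** Each property pulls back because [blockdiag] is linear, continuous and O(4)-equivariant,
    preserves curvature operators and fixes the identity. *)
Lemma blockdiag_cone_curvature_cone Ct :
  curvature_cone Ct -> curvature_cone [set X | curv_op X /\ Ct (blockdiag X)].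
Proof.
move=> [subCt closedCt [convCt scaleCt] actCt int1].
split; first by move=> X [].
- move=> X clX; split.
    by apply: closed_curv_op => B /clX[Y [[cY _] BY]]; exists Y.
  apply: closedCt => B /blockdiag_continuous/clX[Y [[_ CY] BY]].
  by exists (blockdiag Y).
- split.
    move=> X Y k; rewrite !inE => -[cX CX] [cY CY]; rewrite conv_mxE; split.
      by apply: curv_opD => //; exact: curv_opZ.
    rewrite blockdiagD blockdiagZ -conv_mxE; apply: set_mem.
    by apply: convCt; exact: mem_set.
  move=> X s [cX CX] s0; split; first exact: curv_opZ.
  by rewrite blockdiagZ; exact: scaleCt.
- move=> g X og [cX CX]; split; first exact: oact_curv_op.
  by rewrite blockdiag_oact //; exact: actCt.
- apply: cinterior_blockdiag; first exact: curv_op1.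
  by rewrite blockdiag_even ?mulmx1 ?hodgeK.
Qed.

Lemma blockdiag_cone_invariant Ct :
  curvature_cone Ct -> ricci_flow_invariant Ct ->
  (forall X, curv_op X -> nonneg_op X -> Ct X) ->
  ricci_flow_invariant [set X | curv_op X /\ Ct (blockdiag X)].
Proof.
move=> coneCt invCt nonnegCt X [cX [clX nintX]].
have [_ _ [_ scaleCt] _ _] := coneCt.
have CX : Ct (blockdiag X).
  by have [_ closedC _ _ _] := blockdiag_cone_curvature_cone coneCt;
    have [] := closedC _ clX.
have tQ : tangent_cone Ct (blockdiag X) (Qfield (blockdiag X)).
  apply: invCt; split; first exact: blockdiag_curv_op.
  split; first exact: subset_closure.
  by move=> intX; apply: nintX; exact: cinterior_blockdiag.
have cQP : curv_op (Qfield (blockdiag X)).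
  by apply: closed_curv_op => B /tQ[Y [[cY _] BY]]; exists Y.
have cQ : curv_op (Qfield X) by apply: Qfield_curv_op cQP; exact: cX.1.
have CSS : Ct ((X - blockdiag X) *m (X - blockdiag X)).
  set S := X - blockdiag X.
  have symS : S^T = S.
    by rewrite linearB /= cX.1 (blockdiag_curv_op cX).1.
  apply: nonnegCt.
    apply/curv_opP; split; first by rewrite trmx_mul symS.
    exact: tr_hodge_odd_sqr (hodge_blockdiagC X).
  (* The form of S^2 at [eta] is the squared norm of [S *m eta]. *)
  move=> eta; rewrite -mulmxA inner_tr symS.
  by apply: sumr_ge0 => i _; rewrite -expr2 sqr_ge0.
have addZ_continuous (M : 'M[R]_6) : continuous (fun e : R => M + e *: 1%:M).
  apply: mx_continuous => i j.
  suff -> : (fun e : R => (M + e *: 1%:M) i j) =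
      (fun e => M i j + 1%:M i j * e + 0 * e).
    by apply: affine_continuous => e; exact: cvg_id.
  by apply/funext => e; rewrite !mxE; ring.
(* The tangent cone is a closure, so it is enough to find an admissible direction [Qfield X] + e I
   in every neighbourhood [B] of [Qfield X]. *)
move=> B QB.
have : nbhs (Qfield X + 0 *: 1%:M) B by rewrite scale0r addr0.
move=> /addZ_continuous /nbhs_ballP[r /= r0 rB].
have e0 : 0 < r / 2 by apply: divr_gt0; rewrite ?ltr0n.
exists (Qfield X + (r / 2) *: 1%:M); split; last first.
  by apply: rB; rewrite /ball /= sub0r normrN gtr0_norm // ltr_pdivrMr //; lra.
have cQXe : curv_op (Qfield X + (r / 2) *: 1%:M).
  by rewrite addrC; apply: curv_opD => //; exact: curv_op1.
split => //.
have [s s0 Cs] := tangent_cone_perturb coneCt tQ e0.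
exists s => //; split; first by rewrite addrC; exact: curv_opD.
rewrite [X + _]addrC blockdiagD [Qfield X + _]addrC blockdiagD blockdiag_Qfield.
rewrite [blockdiag 1%:M]blockdiag_even ?mulmx1 ?hodgeK //.
(* The projected point is the sum of the point of [Ct] supplied by [tangent_cone_perturb] and a
   positive multiple of S^2. *)
have -> : s *: ((r / 2) *: 1%:M + (Qfield (blockdiag X) +
      (X - blockdiag X) *m (X - blockdiag X))) + blockdiag X =
    (blockdiag X + s *: (Qfield (blockdiag X) + (r / 2) *: 1%:M)) +
    s *: ((X - blockdiag X) *m (X - blockdiag X)).
  move: (Qfield _) (_ *m _) => V T.
  by apply/matrixP => i j; rewrite !mxE; ring.
by apply: curvature_coneD => //; exact: scaleCt.
Qed.

End Preimage.

Theorem theorem0p5 (R : realType) (Ct : set 'M[R]_6)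
  (coneCt : curvature_cone Ct)
  (invCt : ricci_flow_invariant Ct)
  (nonnegCt : forall Rm : 'M[R]_6, curv_op Rm -> nonneg_op Rm -> Ct Rm) :
  let C : set 'M[R]_6 :=
    [set Rm | curv_op Rm /\ Ct ((scal Rm / 12) *: 1%:M + weyl Rm)] in
  [/\ curvature_cone C,
      ricci_flow_invariant C
    & (@conf_flat_scal_flat R) `<=` C].
Proof.
move=> C; have -> : C = [set X | curv_op X /\ Ct (blockdiag X)].
  by apply/seteqP; split=> X [cX CX]; split => //; move: CX;
    rewrite scal_weylE.
split; first exact: blockdiag_cone_curvature_cone.
  exact: blockdiag_cone_invariant.
move=> _ [A [symA trA] <-]; split; first exact: curv_op_wedge.
(* The projection is 0, which is a nonnegative operator. *)
rewrite (blockdiag_odd (wedge_op_odd symA trA)); apply: nonnegCt.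
  exact: curv_op0.
by move=> eta; rewrite mul0mx innerE mulmx0 mxE.
Qed.
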